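(* Let $n\ge 2$ and let $S_n$ be the set of all $n\times n$ real symmetric matrices. Let $\phi : S_n \to S_n$ be an order automorphism. Then there exist an invertible $n \times n$ real matrix $T$ and a symmetric $n \times n$ real matrix $S$ such that $$ \phi (X) = TXT^t + S $$ for every $X \in S_n$.
   Context: For $A,B\in S_n$, $A\le B$ means that $B-A$ is positive semidefinite. $T^t$ is the transpose of $T$. An order automorphism of $S_n$ is a bijective map $\phi:S_n\to S_n$ such that for all $X,Y\in S_n$: $X\le Y\iff\phi(X)\le\phi(Y)$. *)

(* Defs.v *)
From mathcomp Require Export all_boot all_order all_algebra.
From mathcomp Require Export reals.

Set Implicit Arguments.
Unset Strict Implicit.
Unset Printing Implicit Defensive.

Import Order.TTheory GRing.Theory Num.Theory.

Local Open Scope ring_scope.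

Definition symmx (R : realType) (n : nat) : Type :=
  {A : 'M[R]_n | A \is symmetricmx}.

Definition psdmx (R : realType) (n : nat) (A : 'M[R]_n) : Prop :=
  A \is symmetricmx /\ forall v : 'cV[R]_n, 0 <= (v^T *m A *m v) 0 0.

Definition loewner_le (R : realType) (n : nat) (A B : symmx R n) : Prop :=
  psdmx (val B - val A).

Definition order_automorphism (R : realType) (n : nat)
    (phi : symmx R n -> symmx R n) : Prop :=
  bijective phi /\
  forall X Y : symmx R n, loewner_le X Y <-> loewner_le (phi X) (phi Y).

(* The library's [symmetricmx] is stated through sesquilinear forms. *)
Lemma symmetricmxE (R : realType) (n : nat) (A : 'M[R]_n) :
  (A \is symmetricmx) = (A^T == A).
Proof. by rewrite qualifE /= expr0 scale1r map_mx_id // eq_sym. Qed.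

(* Main.v *)
(* On a Loewner interval [A, B] the order is total exactly when B - A has rank
   at most one.  Hence phi maps every line A + R xx^T onto a line of the same
   kind.  For A <= B, lines through A and B with rank-one directions are parallel
   iff every point of the first lies below a point of the second, so the
   image direction depends on x only.  Comparing opposite sides of the
   parallelograms spanned by xx^T and ww^T, with x and w not colinear, shows that
   phi(A + s xx^T) - phi(A) does not change when A moves along ww^T; since n >= 2,
   xx^T itself is a combination of such ww^T, so phi - phi(0) is additive.  Being
   monotone it is linear.

   A linear h mapping each xx^T to some yy^T is a congruence: write h(ee^T) = aa^T
   and h(xx^T) = bb^T.  As h((e + t x)(e + t x)^T) has rank one and is psd for all t,
   M_x = h(ex^T + xe^T) is +-(ab^T + ba^T).  With a.u = 1, the vector
   T x = M_x u - (u^T M_x u / 2) a is linear in x and equal to +-b. *)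
From HB Require Import structures.
Require Import Defs.
From mathcomp Require Import boolp ring lra.

Set Implicit Arguments.
Unset Strict Implicit.
Unset Printing Implicit Defensive.

Import Order.TTheory GRing.Theory Num.Theory.
Local Open Scope ring_scope.

(** * Dot products, quadratic forms and rank-one matrices *)

Definition dot (R : realType) n (u v : 'cV[R]_n) : R := (u^T *m v) 0 0.
Definition bform (R : realType) n (A : 'M[R]_n) u v : R := dot u (A *m v).
Definition outer (R : realType) n (x : 'cV[R]_n) : 'M[R]_n := x *m x^T.

(** Compares quadratic forms only; symmetry is assumed separately, so that bare matrices can replace
    the subtype. *)
Definition qle (R : realType) n (A B : 'M[R]_n) : Prop :=
  forall v, bform A v v <= bform B v v.

Section Forms.

Context {R : realType} {n : nat}.
Implicit Types (A B C D : 'M[R]_n) (u v w x y z : 'cV[R]_n).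

Lemma dotC u v : dot u v = dot v u.
Proof. by rewrite /dot -[in LHS](trmxK v) -trmx_mul mxE. Qed.

Lemma dotDr u v w : dot u (v + w) = dot u v + dot u w.
Proof. by rewrite /dot mulmxDr mxE. Qed.

Lemma dotZr u c v : dot u (c *: v) = c * dot u v.
Proof. by rewrite /dot -scalemxAr mxE. Qed.

Lemma dotDl u v w : dot (u + v) w = dot u w + dot v w.
Proof. by rewrite dotC dotDr !(dotC w). Qed.

Lemma dotZl u c v : dot (c *: u) v = c * dot u v.
Proof. by rewrite dotC dotZr dotC. Qed.

Lemma dot0r u : dot u 0 = 0.
Proof. by rewrite /dot mulmx0 mxE. Qed.

Lemma dot_ge0 v : 0 <= dot v v.
Proof.
by rewrite /dot mxE sumr_ge0 // => i _; rewrite mxE -expr2 sqr_ge0.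
Qed.

Lemma dot_eq0 v : dot v v = 0 -> v = 0.
Proof.
rewrite /dot mxE => /eqP; rewrite psumr_eq0 => [/allP v0|i _]; last first.
  by rewrite mxE -expr2 sqr_ge0.
apply/colP => i; have := v0 i (mem_index_enum i).
by rewrite !mxE -expr2 sqrf_eq0 => /eqP.
Qed.

Lemma dot_gt0 v : v != 0 -> 0 < dot v v.
Proof.
move=> v0; rewrite lt_def dot_ge0 andbT.
by apply: contra_neq v0; exact: dot_eq0.
Qed.

Lemma bformDl A u v w : bform A (u + v) w = bform A u w + bform A v w.
Proof. exact: dotDl. Qed.

Lemma bformDr A u v w : bform A u (v + w) = bform A u v + bform A u w.
Proof. by rewrite /bform mulmxDr dotDr. Qed.

Lemma bformZl A c u v : bform A (c *: u) v = c * bform A u v.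
Proof. exact: dotZl. Qed.

Lemma bformZr A c u v : bform A u (c *: v) = c * bform A u v.
Proof. by rewrite /bform -scalemxAr dotZr. Qed.

Lemma bformD A B u v : bform (A + B) u v = bform A u v + bform B u v.
Proof. by rewrite /bform mulmxDl dotDr. Qed.

Lemma bformZ c A u v : bform (c *: A) u v = c * bform A u v.
Proof. by rewrite /bform -scalemxAl dotZr. Qed.

Lemma bformN A u v : bform (- A) u v = - bform A u v.
Proof. by rewrite -scaleN1r bformZ mulN1r. Qed.

Lemma bformB A B u v : bform (A - B) u v = bform A u v - bform B u v.
Proof. by rewrite bformD bformN. Qed.

Lemma bform0 u v : bform (0 : 'M[R]_n) u v = 0.
Proof. by rewrite /bform mul0mx dot0r. Qed.

Lemma bform_mul x y u v : bform (x *m y^T) u v = dot x u * dot y v.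
Proof.
rewrite /bform /dot -mulmxA mulmxA mxE big_ord1; congr (_ * _).
exact: dotC.
Qed.

Lemma bform_outer x u v : bform (outer x) u v = dot x u * dot x v.
Proof. exact: bform_mul. Qed.

Definition bformE := (bformDl, bformDr, bformZl, bformZr, bformD, bformZ,
  bformN, bform0, bform_outer).

Lemma bformC A u v : A^T = A -> bform A u v = bform A v u.
Proof.
move=> sA; rewrite /bform dotC /dot trmx_mul sA.
by rewrite mulmxA.
Qed.

Lemma bform_delta A i j : bform A (delta_mx i 0) (delta_mx j 0) = A i j.
Proof.
by rewrite /bform /dot trmx_delta -colE -rowE !mxE.
Qed.

(** Polarization: expanding at [u + v] recovers the mixed values, which on basis vectors are the
    entries. *)
Lemma bform_inj A B :
  A^T = A -> B^T = B -> (forall v, bform A v v = bform B v v) -> A = B.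
Proof.
move=> sA sB eAB; apply/matrixP => i j.
rewrite -(bform_delta A) -(bform_delta B).
move: (delta_mx i 0) (delta_mx j 0) => u v.
have := eAB (u + v); rewrite !bformE !eAB (bformC v u sA) (bformC v u sB).
lra.
Qed.

Lemma symD A B : A^T = A -> B^T = B -> (A + B)^T = A + B.
Proof. by rewrite linearD /= => -> ->. Qed.

Lemma symZ c A : A^T = A -> (c *: A)^T = c *: A.
Proof. by rewrite linearZ /= => ->. Qed.

Lemma symB A B : A^T = A -> B^T = B -> (A - B)^T = A - B.
Proof. by rewrite linearB /= => -> ->. Qed.

Lemma sym_outer x : (outer x)^T = outer x.
Proof. by rewrite /outer trmx_mul trmxK. Qed.

Lemma outerZ c x : outer (c *: x) = c ^+ 2 *: outer x.
Proof. by rewrite /outer linearZ /= -scalemxAl -scalemxAr scalerA. Qed.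

Lemma outer_eq0 x : outer x = 0 -> x = 0.
Proof.
move=> /(congr1 (fun M => bform M x x)); rewrite bform_outer bform0 => /eqP.
by rewrite -expr2 sqrf_eq0 => /eqP; exact: dot_eq0.
Qed.

(** The residual [x - c *: w] is orthogonal to [w], hence by hypothesis to [x], hence to itself. For
    [w = 0] the first orthogonality is trivial. *)
Lemma colinear_of_orth x w :
  (forall v, dot w v = 0 -> dot x v = 0) -> exists c, x = c *: w.
Proof.
move=> H; exists (dot x w / dot w w).
set c := _ / _; have wv : dot w (x - c *: w) = 0.
  rewrite -scaleNr dotDr dotZr (dotC w x) mulNr.
  have [->|w0] := eqVneq w 0; first by rewrite !dot0r mulr0 subr0.
  by rewrite /c divfK ?subrr // gt_eqF // dot_gt0.
apply/eqP; rewrite -subr_eq0; apply/eqP/dot_eq0.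
by rewrite -{1}scaleNr dotDl dotZl wv mulr0 addr0; apply: H.
Qed.

Lemma colinear_of_outer c x w : outer x = c *: outer w -> exists k, x = k *: w.
Proof.
move=> E; apply: colinear_of_orth => v wv.
have := congr1 (fun M => bform M v v) E.
rewrite bformZ !bform_outer wv !mulr0 => /eqP.
by rewrite -expr2 sqrf_eq0 => /eqP.
Qed.

Lemma outer_polar x y :
  outer (x + y) = outer x + outer y + (x *m y^T + y *m x^T).
Proof.
by rewrite /outer linearD /= mulmxDl !mulmxDr [y *m x^T + _]addrC addrACA.
Qed.

(** Rank-one matrices span the symmetric ones, so an induction can add them one at a time. *)
Lemma sym_ind (P : 'M[R]_n -> Prop) : P 0 ->
  (forall A t w, A^T = A -> P A -> P (A + t *: outer w)) ->
  forall A, A^T = A -> P A.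
Proof.
move=> P0 PD A sA.
(* The symmetric matrices whose addition preserves [P] are closed under sums. *)
pose Q B := B^T = B /\ forall A, A^T = A -> P A -> P (A + B).
have QD B C : Q B -> Q C -> Q (B + C).
  move=> [sB QB] [sC QC]; split=> [|A' sA' PA']; first exact: symD.
  by rewrite addrA; apply: QC; [exact: symD | exact: QB].
have Qw t w : Q (t *: outer w).
  by split=> [|A' sA' PA']; [exact/symZ/sym_outer | exact: PD].
have Q0 : Q 0 by split=> [|A' _ PA']; rewrite ?trmx0 ?addr0.
(* Write $A = (A + A^T)/2$ and express $e_i e_j^T + e_j e_i^T$ through squares by polarization. *)
have AE : A = \sum_i \sum_j (A i j / 2 *: outer (delta_mx i 0 + delta_mx j 0)
    + (- (A i j / 2)) *: outer (delta_mx i 0)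
    + (- (A i j / 2)) *: outer (delta_mx j 0)).
  transitivity (2^-1 *: (A + A^T)).
    by rewrite sA -mulr2n -scaler_nat scalerA mulVf ?scale1r ?pnatr_eq0.
  rewrite {1 2}(matrix_sum_delta A) linear_sum /= -big_split /= scaler_sumr.
  apply: eq_bigr => i _; rewrite linear_sum /= -big_split /= scaler_sumr.
  apply: eq_bigr => j _; rewrite linearZ /= trmx_delta outer_polar.
  rewrite !trmx_delta !mul_delta_mx -scalerDr scalerA mulrC.
  rewrite !scalerDr !scaleNr; set a := _ *: outer _; set b := _ *: outer _.
  by rewrite (addrC (a + b)) -addrA -opprD addrK.
suff [_ QA] : Q A by rewrite -[A]add0r; apply: QA => //; exact: trmx0.
rewrite AE; apply: big_ind => // i _; apply: big_ind => // j _.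
by apply: (QD) => //; apply: (QD).
Qed.

End Forms.

(** * Order intervals and the criterion for rank one *)

Section Order.

Context {R : realType} {n : nat}.
Implicit Types (A B C D E F P : 'M[R]_n) (u v w x y z : 'cV[R]_n).

Lemma affine_ge0_slope0 (b c : R) : (forall t, 0 <= c + t * b) -> b = 0.
Proof.
move=> H; apply/eqP; apply: contraT => b0.
have := H (- (c + 1) / b); rewrite divfK // opprD addrA subrr add0r.
by rewrite oppr_ge0 ler10.
Qed.

Lemma qle0P A B : qle A B <-> qle 0 (B - A).
Proof.
by split=> H v; have := H v; rewrite bformB bform0 subr_ge0.
Qed.

Lemma qle_add2l C A B : qle A B -> qle (C + A) (C + B).
Proof. by move=> H v; rewrite !bformD lerD2l. Qed.

Lemma qle_add2lI C A B : qle (C + A) (C + B) -> qle A B.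
Proof. by move=> H v; have := H v; rewrite !bformD lerD2l. Qed.

Lemma qle_trans A B C : qle A B -> qle B C -> qle A C.
Proof. by move=> AB BC v; apply: le_trans (AB v) (BC v). Qed.

Lemma qle_outer s t x : s <= t -> qle (s *: outer x) (t *: outer x).
Proof.
by move=> st v; rewrite !bformZ bform_outer ler_wpM2r // -expr2 sqr_ge0.
Qed.

(** With no quadratic term, the form at [u + t *: v] is affine in [t]; being nonnegative, it has
    slope zero. *)
Lemma psd_isotropic P u v :
  P^T = P -> qle 0 P -> bform P v v = 0 -> bform P u v = 0.
Proof.
move=> sP P0 vv; suff : 2 * bform P u v = 0 by move=> ?; lra.
apply: (@affine_ge0_slope0 _ (bform P u u)) => t.
have := P0 (u + t *: v); rewrite !bformE vv (bformC v u sP); lra.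
Qed.

Lemma psd_cauchy_schwarz P u v : P^T = P -> qle 0 P ->
  bform P u v ^+ 2 <= bform P u u * bform P v v.
Proof.
move=> sP P0; have [vv|vv] := eqVneq (bform P v v) 0.
  by rewrite (psd_isotropic u sP P0 vv) vv expr0n /= mulr0.
have v0 : 0 < bform P v v by rewrite lt_def vv; have := P0 v; rewrite bform0.
(* The usual minimizing vector, cleared of its denominator. *)
have := P0 (bform P v v *: u - bform P u v *: v).
rewrite -scaleNr !bformE (bformC v u sP) => H.
suff : 0 <= bform P v v * (bform P u u * bform P v v - bform P u v ^+ 2).
  by rewrite pmulr_rge0 // subr_ge0.
lra.
Qed.

(** [E] is squeezed to zero on the orthogonal complement of [x], which therefore lies in its kernel.
    One value, at some [w] with [dot x w = 1], then determines [E]. *)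
Lemma qle_outer_colinear E x : E^T = E -> qle 0 E -> qle E (outer x) ->
  exists s, E = s *: outer x.
Proof.
move=> sE E0 Ex; have [x0|x0] := eqVneq x 0.
  exists 0; rewrite scale0r; apply: bform_inj => [//||v]; first exact: trmx0.
  have := Ex v; have := E0 v; rewrite x0 bform_outer bform0 dotC dot0r mulr0.
  by move=> ? ?; apply/eqP; rewrite eq_le; apply/andP.
have xx := dot_gt0 x0.
have orth v : dot x v = 0 -> bform E v v = 0.
  move=> xv; have := Ex v; have := E0 v; rewrite bform_outer bform0 xv mulr0.
  by move=> ? ?; apply/eqP; rewrite eq_le; apply/andP.
have [w xw] : exists w, dot x w = 1.
  by exists ((dot x x)^-1 *: x); rewrite dotZr mulVf // gt_eqF.
exists (bform E w w); apply: bform_inj => [//||v]; first exact/symZ/sym_outer.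
have v'0 : dot x (v - dot x v *: w) = 0.
  by rewrite -scaleNr dotDr dotZr xw mulr1 subrr.
rewrite -{1 2}(subrK (dot x v *: w) v); move: v'0.
move: (v - dot x v *: w) => v' v'0.
rewrite bformZ bform_outer !bformE. 
rewrite (orth _ v'0) (bformC v' w sE).
by rewrite (psd_isotropic w sE E0 (orth _ v'0)); ring.
Qed.

(** Totality of the interval, stated through the order alone so that order isomorphisms transport
    it. *)
Definition qchain A B := forall C D, C^T = C -> D^T = D ->
  qle A C -> qle C B -> qle A D -> qle D B -> qle C D \/ qle D C.

Lemma qchain_outer A x : A^T = A -> qchain A (A + outer x).
Proof.
move=> sA C D sC sD AC CB AD DB.
have aux E : E^T = E -> qle A E -> qle E (A + outer x) ->
    exists s, E = A + s *: outer x.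
  move=> sE AE EB; have [||s sEA] := @qle_outer_colinear (E - A) x (symB sE sA).
  - exact: (qle0P _ _).1.
  - by apply: (@qle_add2lI A); rewrite addrC subrK.
  by exists s; rewrite -sEA addrC subrK.
have [s ->] := aux _ sC AC CB; have [t ->] := aux _ sD AD DB.
by case/orP: (le_total s t) => st; [left|right]; apply/qle_add2l/qle_outer.
Qed.

(* Lies below [P] by Cauchy-Schwarz and agrees with [P] at [v]. *)
Definition psd_part P v : 'M[R]_n := (bform P v v)^-1 *: outer (P *m v).

Lemma bform_psd_part P u v : P^T = P ->
  bform (psd_part P v) u u = (bform P v v)^-1 * bform P u v ^+ 2.
Proof. by move=> sP; rewrite bformZ bform_outer dotC -expr2. Qed.

Lemma sym_psd_part P v : (psd_part P v)^T = psd_part P v.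
Proof. exact/symZ/sym_outer. Qed.

Lemma psd_part_ge0 P v : P^T = P -> qle 0 P -> qle 0 (psd_part P v).
Proof.
move=> sP P0 u; rewrite bform_psd_part // bform0 mulr_ge0 ?sqr_ge0 //.
by rewrite invr_ge0; have := P0 v; rewrite bform0.
Qed.

Lemma psd_part_le P v : P^T = P -> qle 0 P -> 0 < bform P v v ->
  qle (psd_part P v) P.
Proof.
move=> sP P0 v0 u; rewrite bform_psd_part // mulrC ler_pdivrMr //.
exact: psd_cauchy_schwarz.
Qed.

(** If [P] differs from its rank-one part [E] at [v], then [P - E] has a nonzero rank-one part [F].
    Both lie in the interval from 0 to [P], yet they are incomparable: [F] vanishes at [v] where [E]
    is positive, and the reverse happens at another vector. *)
Lemma qchain_psd_rank1 P : P^T = P -> qle 0 P -> qchain 0 P ->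
  exists x, P = outer x.
Proof.
move=> sP P0 ch.
have [[v v0]|Pn] := pselect (exists v, 0 < bform P v v); last first.
  exists 0; apply: bform_inj => [//||v]; first exact: sym_outer.
  rewrite bform_outer dotC dot0r mulr0; apply/eqP; rewrite eq_le.
  have := P0 v; rewrite bform0 => ->; rewrite andbT leNgt; apply/negP => v0.
  by apply: Pn; exists v.
have E0 := psd_part_ge0 v sP P0; have EP := psd_part_le sP P0 v0.
set E := psd_part P v in E0 EP.
have sE : E^T = E := sym_psd_part P v.
have sQ := symB sP sE; have Q0 : qle 0 (P - E) by apply: (qle0P _ _).1.
suff PE u : bform (P - E) u u <= 0.
  exists ((Num.sqrt (bform P v v))^-1 *: (P *m v)).
  rewrite outerZ exprVn sqr_sqrtr ?ltW // -/(psd_part P v) -/E.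
  apply: bform_inj => // u; apply/eqP; rewrite -subr_eq0 -bformB eq_le PE.
  by have := Q0 u; rewrite bform0.
rewrite leNgt; apply/negP => u0.
have Ev w : bform E w w = (bform P v v)^-1 * bform P w v ^+ 2.
  exact: bform_psd_part.
have Qv : bform (P - E) v v = 0.
  by rewrite bformB Ev expr2 mulKf ?subrr // gt_eqF.
pose F := psd_part (P - E) u.
have Fv : bform F v v = 0.
  rewrite bform_psd_part // (bformC v u sQ) (psd_isotropic u sQ Q0 Qv).
  by rewrite expr0n /= mulr0.
have F0 : qle 0 F by exact: psd_part_ge0.
have sF : F^T = F by exact: sym_psd_part.
have FP : qle F P.
  apply: (@qle_trans _ (P - E)); first exact: psd_part_le.
  by move=> w; rewrite bformB gerBl; have := E0 w; rewrite bform0.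
have Fu : bform F u u = bform (P - E) u u.
  by rewrite bform_psd_part // expr2 mulKf // gt_eqF.
case: (ch _ _ sE sF E0 EP F0 FP); move: F Fv F0 sF Fu {FP} => F Fv F0 sF Fu.
  move=> /(_ v).
  by rewrite Fv Ev expr2 mulKf ?gt_eqF // leNgt v0.
(* Makes [u - c *: v] orthogonal to [v] for [P], so [E] vanishes there, while [F] keeps its positive
   value at [u] because [v] is in its kernel. *)
pose c := bform P u v / bform P v v.
move=> /(_ (u + (- c) *: v)).
have -> : bform E (u + (- c) *: v) (u + (- c) *: v) = 0.
  by rewrite Ev !bformE mulNr /c divfK ?gt_eqF // subrr expr0n /= mulr0.
have Fvu : bform F u v = 0 by exact: psd_isotropic.
rewrite !bformE Fv Fvu (bformC v u sF) Fvu !mulr0 !addr0.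
by rewrite Fu leNgt u0.
Qed.

Lemma qchain_rank1 A B : A^T = A -> B^T = B -> qle A B -> qchain A B ->
  exists x, B = A + outer x.
Proof.
move=> sA sB AB ch; have [||x Px] :=
  @qchain_psd_rank1 (B - A) (symB sB sA).
- exact: (qle0P _ _).1.
- move=> C D sC sD C0 CP D0 DP.
  have sh E : qle 0 E -> qle E (B - A) -> qle A (A + E) /\ qle (A + E) B.
    move=> E0 EP; split; first by rewrite -{1}[A]addr0; exact: qle_add2l.
    by rewrite -[B](subrK A) [B - A + A]addrC; apply: qle_add2l.
  have [AC CB] := sh _ C0 CP; have [AD DB] := sh _ D0 DP.
  by case: (ch _ _ (symD sA sC) (symD sA sD) AC CB AD DB) => /qle_add2lI;
    [left|right].
by exists x; rewrite -Px addrC subrK.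
Qed.

End Order.

(** * Order isomorphisms: from lines to linearity *)

(** The inverse is part of the data, so every result about [f] also applies to [g]. *)
Record qiso (R : realType) n (f g : 'M[R]_n -> 'M[R]_n) : Prop := QIso {
  qiso_sym : forall A, A^T = A -> (f A)^T = f A;
  qiso_symV : forall A, A^T = A -> (g A)^T = g A;
  qisoK : forall A, A^T = A -> g (f A) = A;
  qisoVK : forall A, A^T = A -> f (g A) = A;
  qiso_le : forall A B, A^T = A -> B^T = B -> (qle A B <-> qle (f A) (f B)) }.

Lemma addrK_common (V : zmodType) (a b c : V) : a + b - (a + c) = b - c.
Proof. by rewrite opprD addrACA subrr add0r. Qed.

Section OrderIso.

Context {R : realType} {n : nat}.
Implicit Types (A B C D E F P : 'M[R]_n) (u v w x y z : 'cV[R]_n).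
Implicit Types f g : 'M[R]_n -> 'M[R]_n.

Lemma qiso_inv f g : qiso f g -> qiso g f.
Proof.
case=> sf sg fK gK lef; split=> // A B sA sB.
rewrite -{1}(gK _ sA) -{1}(gK _ sB).
by have [] := lef _ _ (sg _ sA) (sg _ sB); split.
Qed.

Lemma qiso_homo f g A B :
  qiso f g -> A^T = A -> B^T = B -> qle A B -> qle (f A) (f B).
Proof. by move=> h sA sB; case: (qiso_le h sA sB). Qed.

Lemma qiso_homoI f g A B :
  qiso f g -> A^T = A -> B^T = B -> qle (f A) (f B) -> qle A B.
Proof. by move=> h sA sB; case: (qiso_le h sA sB). Qed.

Lemma qiso_inj f g A B : qiso f g -> A^T = A -> B^T = B -> f A = f B -> A = B.
Proof. by move=> h sA sB E; rewrite -(qisoK h sA) E (qisoK h sB). Qed.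

Lemma sym_addZ_outer A t w : A^T = A -> (A + t *: outer w)^T = A + t *: outer w.
Proof. by move=> sA; apply: symD => //; exact/symZ/sym_outer. Qed.

(** The interval above [A] is a chain, hence so is its image, and a chain interval has rank-one
    length. *)
Lemma qiso_outer f g A x : qiso f g -> A^T = A ->
  exists y, f (A + outer x) = f A + outer y.
Proof.
move=> h sA; have sB : (A + outer x)^T = A + outer x.
  by apply: symD => //; exact: sym_outer.
have AB : qle A (A + outer x).
  move=> v; rewrite bformD bform_outer lerDl -expr2; exact: sqr_ge0.
apply: qchain_rank1; [exact: (qiso_sym h)|exact: (qiso_sym h)| |].
  exact: (qiso_homo h).
move=> C D sC sD AC CB AD DB.
have sgC := qiso_symV h sC; have sgD := qiso_symV h sD.
rewrite -(qisoVK h sC) -(qisoVK h sD) in AC CB AD DB *.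
have := @qchain_outer _ _ A x sA _ _ sgC sgD.
by case=> [|||| CD|DC]; [exact: (qiso_homoI h)..
  |left; exact: (qiso_homo h)|right; exact: (qiso_homo h)].
Qed.

Lemma qiso_segment f g A x s t : qiso f g -> A^T = A -> s <= t ->
  exists z, f (A + t *: outer x) = f (A + s *: outer x) + outer z.
Proof.
move=> h sA st.
(* The square root absorbs the length of the segment into the vector. *)
have [z fz] := qiso_outer (Num.sqrt (t - s) *: x) h (sym_addZ_outer s x sA).
exists z; rewrite -fz outerZ sqr_sqrtr ?subr_ge0 // -addrA -scalerDl.
by rewrite [s + _]addrC subrK.
Qed.

Lemma qiso_line f g A x y s : qiso f g -> A^T = A ->
  f (A + outer x) = f A + outer y ->
  exists c, f (A + s *: outer x) = f A + c *: outer y.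
Proof.
move=> h sA fy; have [x0|x0] := eqVneq x 0.
  by exists 0; rewrite x0 /outer mul0mx scaler0 scale0r !addr0.
(* The parameters 0, 1 and [s] all lie in $[-N, N]$, whose image lies on a single line along
   [outer z]. The points at 0 and 1 express [outer y] through [outer z], with a nonzero factor by
   injectivity. *)
pose N : R := `|s| + 1.
have sN : - N <= s <= N by rewrite -ler_norml /N; lra.
have [z fz] : exists z, f (A + N *: outer x) = f (A + - N *: outer x) + outer z.
  by apply: qiso_segment h sA _; rewrite -subr_ge0 /N; have := normr_ge0 s; lra.
have onz (t : R) : - N <= t <= N ->
    exists r, f (A + t *: outer x) = f (A + - N *: outer x) + r *: outer z.
  case/andP=> Nt tN.
  have sf r : (f (A + r *: outer x))^T = f (A + r *: outer x).
    exact/(qiso_sym h)/sym_addZ_outer.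
  have le r r' : r <= r' -> qle (f (A + r *: outer x)) (f (A + r' *: outer x)).
    by move=> rr'; apply: (qiso_homo h); [exact: sym_addZ_outer..|exact/qle_add2l/qle_outer].
  have [||r Er] := qle_outer_colinear (symB (sf t) (sf (- N))) _ (x := z).
  - by apply: (qle0P _ _).1; exact: le.
  - apply: (@qle_add2lI _ _ (f (A + - N *: outer x))).
    by rewrite -fz addrCA subrr addr0; exact: le.
  by exists r; rewrite -Er addrCA subrr addr0.
have [|r0 E0] := onz 0; first by rewrite /N; have := normr_ge0 s; lra.
have [|r1 E1] := onz 1; first by rewrite /N; have := normr_ge0 s; lra.
have [rs Es] := onz s sN.
rewrite scale0r addr0 in E0; rewrite scale1r in E1.
have Ey : outer y = (r1 - r0) *: outer z.
  rewrite scalerBl -(addrK (f A) (outer y)) [_ + f A]addrC -fy E1 E0.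
  exact: addrK_common.
have r10 : r1 - r0 != 0.
  apply: contra_neq x0 => r10; apply: outer_eq0.
  have := @qiso_inj f g (A + outer x) A h (symD sA (sym_outer x)) sA.
  rewrite fy Ey r10 scale0r addr0 => /(_ erefl) /(congr1 (fun B => B - A)).
  by rewrite addrAC subrr add0r.
exists ((rs - r0) / (r1 - r0)).
by rewrite Ey scalerA divfK // Es E0 -addrA -scalerDl [r0 + _]addrC subrK.
Qed.

Lemma qiso_line_onto f g A x y r : qiso f g -> A^T = A ->
  f (A + outer x) = f A + outer y ->
  exists s, f (A + s *: outer x) = f A + r *: outer y.
Proof.
move=> h sA fy; have sfA := qiso_sym h sA.
have [|s gs] := @qiso_line g f (f A) y x r (qiso_inv h) sfA.
  by rewrite -fy !(qisoK h) //; exact: symD (sym_outer x).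
by exists s; rewrite -{1}(qisoK h sA) -gs (qisoVK h) //; exact: sym_addZ_outer.
Qed.

(* Lines through comparable points in a common direction are dominated
   pointwise one by the other, which their images can only be when parallel. *)
Lemma qiso_parallel f g A B x y z : qiso f g -> A^T = A -> B^T = B ->
  qle A B ->
  f (A + outer x) = f A + outer y -> f (B + outer x) = f B + outer z ->
  exists k, outer y = k *: outer z.
Proof.
move=> h sA sB AB fy fz.
suff [k ->] : exists k, y = k *: z by exists (k ^+ 2); exact: outerZ.
apply: colinear_of_orth => v zv; apply/eqP; apply: contraT => yv.
have d0 : 0 < dot y v ^+ 2 by rewrite exprn_even_gt0.
(* At [v] this point of the first image line exceeds [f B] by 1, while the second image line is
   constant there. *)
pose r := (bform (f B) v v - bform (f A) v v + 1) / dot y v ^+ 2.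
have [s fs] := qiso_line_onto r h sA fy.
have [c fc] := qiso_line s h sB fz.
have : qle (f (A + s *: outer x)) (f (B + s *: outer x)).
  apply: (qiso_homo h); [exact: sym_addZ_outer..|].
  by move=> u; rewrite !bformD lerD2r.
move=> /(_ v); rewrite fs fc !bformD !bformZ !bform_outer zv -!expr2.
by rewrite /r divfK ?gt_eqF // expr0n /= mulr0; lra.
Qed.

(** Each induction step moves the base point along a rank-one matrix, to a comparable one: above or
    below according to the sign of [t]. The direction is thus carried over from the base point 0. *)
Lemma qiso_direction f g A x : qiso f g -> A^T = A ->
  exists k, f (A + outer x) = f A + k *: (f (outer x) - f 0).
Proof.
move=> h; have [->|x0] := eqVneq x 0.
  by exists 0; rewrite scale0r /outer mul0mx !addr0.
move: A; apply: sym_ind => [|A t w sA [k fA]].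
  by exists 1; rewrite scale1r add0r addrC subrK.
have sB := sym_addZ_outer t w sA; set B := A + _ in sB *.
have [a fa] := qiso_outer x h sA; have [b fb] := qiso_outer x h sB.
have nz C c : C^T = C -> f (C + outer x) = f C + outer c -> outer c != 0.
  move=> sC fc; apply: contra_neq x0 => c0; apply: outer_eq0.
  have := @qiso_inj f g (C + outer x) C h (symD sC (sym_outer x)) sC.
  rewrite fc c0 addr0 => /(_ erefl) /(congr1 (fun B => B - C)).
  by rewrite addrAC subrr add0r.
have [l bl] : exists l, outer b = l *: outer a.
  case/orP: (le_total 0 t) => t0; last first.
    apply: (qiso_parallel h sB sA _ fb fa).
    by rewrite -[A in qle _ A]addr0 -(scale0r (outer w)); apply/qle_add2l/qle_outer.
  have [|l al] := qiso_parallel h sA sB _ fa fb.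
    by rewrite -{1}[A]addr0 -(scale0r (outer w)); apply/qle_add2l/qle_outer.
  exists l^-1; rewrite al scalerA mulVf ?scale1r //.
  by apply: contra_neq (nz _ _ sA fa) => l0; rewrite al l0 scale0r.
exists (l * k); rewrite fb bl; congr (_ + _).
rewrite -scalerA; congr (_ *: _); move: fA; rewrite fa; exact: addrI.
Qed.

Lemma qiso_direction_line f g A x s : qiso f g -> A^T = A ->
  exists c, f (A + s *: outer x) = f A + c *: (f (outer x) - f 0).
Proof.
move=> h sA; have [y fy] := qiso_outer x h sA.
have [c fc] := qiso_line s h sA fy; have [k fk] := qiso_direction x h sA.
exists (c * k); rewrite fc -scalerA; congr (_ + _ *: _).
by move: fk; rewrite fy; exact: addrI.
Qed.

(** If [c] were nonzero, [f (outer x)] would lie on the image of the line spanned by [outer w], and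
    injectivity would make [x] a multiple of [w]. *)
Lemma qiso_independent f g x w c l : qiso f g -> ~ (exists k, x = k *: w) ->
  c *: (f (outer x) - f 0) = l *: (f (outer w) - f 0) -> c = 0.
Proof.
move=> h xw E; apply/eqP; apply: contraT => c0; case: xw.
have s0 : (0 : 'M[R]_n)^T = 0 := trmx0 _ _ _.
have [y] := qiso_outer w h s0; rewrite add0r => fy.
have [|s fs] := @qiso_line_onto f g 0 w y (l / c) h s0; first by rewrite add0r.
apply: (@colinear_of_outer _ _ s).
apply: (qiso_inj h); [exact: sym_outer|exact/symZ/sym_outer|].
move: fs; rewrite add0r => ->; rewrite mulrC -scalerA.
have -> : outer y = f (outer w) - f 0 by rewrite fy [f 0 + _]addrC addrK.
by rewrite -E scalerA mulVf // scale1r addrCA subrr addr0.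
Qed.

(* Opposite sides of a parallelogram spanned by rank-one directions. *)
Lemma qiso_shift f g A x w s t : qiso f g -> A^T = A ->
    ~ (exists k, x = k *: w) ->
  f (A + t *: outer w + s *: outer x) - f (A + t *: outer w) =
  f (A + s *: outer x) - f A.
Proof.
move=> h sA xw.
have [c fc] := qiso_direction_line x s h (sym_addZ_outer t w sA).
have [c' fc'] := qiso_direction_line x s h sA.
have [d fd] := qiso_direction_line w t h (sym_addZ_outer s x sA).
have [d' fd'] := qiso_direction_line w t h sA.
(* Both ways around the parallelogram end at the same point, so $c - c'$ times one direction equals
   $d' - d$ times the other, up to sign. *)
suff cc' : c - c' = 0.
  by rewrite fc fc' ![f _ + _]addrC !addrK; congr (_ *: _); exact: subr0_eq.
apply: (qiso_independent h xw (l := d - d')); rewrite !scalerBl.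
move: fc; rewrite addrAC fd fc' fd' -!addrA => /addrI E.
by apply/eqP; rewrite subr_eq addrAC -[X in _ == X - _]addrC E addrC addrK.
Qed.

Lemma outer_parallelogram x z :
  outer (x + z) + outer (x - z) = 2 *: outer x + 2 *: outer z.
Proof.
rewrite -[- z]scaleN1r; apply: bform_inj => [||v].
- by apply: symD; exact: sym_outer.
- by apply: symD; exact/symZ/sym_outer.
by rewrite !bformE !dotDl !dotZl; ring.
Qed.

Lemma not_colinear_vector x : (1 < n)%N -> x != 0 ->
  exists z, ~ (exists k, z = k *: x).
Proof.
move=> n1 x0; have [i xi] : exists i, x i 0 != 0.
  apply: contrapT => H; case/eqP: x0; apply/colP => i; rewrite mxE.
  by apply/eqP; apply: contraT => xi; case: H; exists i.
have [j ji] : exists j : 'I_n, j != i.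
  have : (0 < #|[pred j | j != i]|)%N.
    have := cardC1 i; rewrite card_ord => E.
    by rewrite (eq_card (B := predC1 i)) // E; case: (n) n1 => [|[]].
  by case/card_gt0P => j; rewrite inE => ji; exists j.
exists (delta_mx j 0) => -[k /colP E].
have := E i; rewrite !mxE (negbTE (_ : i != j)) 1?eq_sym //= => /esym/eqP.
rewrite mulf_eq0 (negbTE xi) orbF => /eqP k0.
by have := E j; rewrite !mxE !eqxx k0 mul0r => /eqP; rewrite oner_eq0.
Qed.

(** The base point moves by rank-one steps. Steps not colinear with [x] are handled by [qiso_shift];
    a colinear one is replaced by three that are not, using a second dimension. *)
Lemma qiso_translation f g A x s : (1 < n)%N -> qiso f g -> A^T = A ->
  f (A + s *: outer x) - f A = f (s *: outer x) - f 0.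
Proof.
move=> n1 h; have [->|x0] := eqVneq x 0.
  by rewrite /outer mul0mx scaler0 addr0 !subrr.
move: A; apply: sym_ind => [|A t w sA IH]; first by rewrite add0r.
have [[k xw]|xw] := pselect (exists k, x = k *: w); last first.
  by rewrite (qiso_shift s t h sA xw).
have [z zx] := not_colinear_vector n1 x0.
have k0 : k != 0 by apply: contra_neq x0 => k0; rewrite xw k0 scale0r.
have wx : w = k^-1 *: x by rewrite xw scalerA mulVf ?scale1r.
(* The parallelogram law solved for [outer x]; the factor $k^2$ comes from [x = k *: w]. *)
have -> : t *: outer w = (t / k ^+ 2 / 2) *: outer (x + z) +
    (t / k ^+ 2 / 2) *: outer (x - z) + (- (t / k ^+ 2)) *: outer z.
  rewrite -scalerDr outer_parallelogram -scalerDr scalerA divfK ?pnatr_eq0 //.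
  by rewrite scalerDr scaleNr addrK wx outerZ scalerA exprVn.
have nz l : l != 0 -> ~ exists c, x = c *: (x + l *: z).
  move=> l0 [c]; have [->|c0] := eqVneq c 0.
    by rewrite scale0r => /eqP; rewrite (negbTE x0).
  rewrite scalerDr scalerA => /(congr1 (fun v => (c * l)^-1 *: (v - c *: x))).
  rewrite /= [c *: x + _]addrC addrK scalerA mulVf ?mulf_neq0 // scale1r => E.
  by case: zx; exists ((c * l)^-1 * (1 - c)); rewrite -E -scalerA scalerBl scale1r.
have xz : ~ exists c, x = c *: z.
  move=> [c xz]; have c0 : c != 0 by apply: contra_neq x0 => c0; rewrite xz c0 scale0r.
  by case: zx; exists c^-1; rewrite xz scalerA mulVf ?scale1r.
have xDz : ~ exists c, x = c *: (x + z).
  by rewrite -[z]scale1r; apply: nz; exact: oner_neq0.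
have xBz : ~ exists c, x = c *: (x - z).
  by rewrite -[- z]scaleN1r; apply: nz; rewrite oppr_eq0 oner_neq0.
rewrite !addrA (qiso_shift _ _ h _ xz); last exact/sym_addZ_outer/sym_addZ_outer.
rewrite (qiso_shift _ _ h _ xBz); last exact: sym_addZ_outer.
by rewrite (qiso_shift _ _ h sA xDz).
Qed.

(** Cauchy's equation: monotonicity between consecutive integers bounds the deviation from linearity
    by [k 1], and a bounded additive deviation is zero. *)
Lemma additive_monotone_linear (k : R -> R) :
  {morph k : s t / s + t} -> (forall t, 0 <= t -> 0 <= k t) ->
  forall t, k t = t * k 1.
Proof.
move=> kD k0.
have kB : {morph k : s t / s - t}.
  by move=> s t; apply: (@addIr _ (k t)); rewrite -kD !subrK.
have kh s t : s <= t -> k s <= k t.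
  by move=> st; rewrite -subr_ge0 -kB k0 // subr_ge0.
pose k' : {additive R -> R} := HB.pack k (GRing.isZmodMorphism.Build R R k kB).
have kZ (m : int) : k m%:~R = m%:~R * k 1.
  by rewrite -[k]/(k' : R -> R) raddfMz mulrzl.
have bnd t : `|k t - t * k 1| <= k 1.
  have k1 := k0 1 ler01.
  have := Num.Theory.floor_itv t => /andP[lo /ltW hi].
  have := kh _ _ lo; have := kh _ _ hi; rewrite !kZ intrD mulrDl mul1r.
  have := ler_wpM2r k1 lo; have := ler_wpM2r k1 hi; rewrite intrD mulrDl mul1r.
  by rewrite ler_norml => *; apply/andP; split; lra.
move=> t; apply/eqP; rewrite -subr_eq0 -normr_le0 leNgt; apply/negP => d0.
(* At [N%:R * t] the deviation is [N] times [d], which exceeds the bound. *)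
set d := `|_| in d0; pose N := Num.bound (k 1 / d).
have := archi_boundP (divr_ge0 (k0 1 ler01) (ltW d0)).
rewrite -/N ltr_pdivrMr // ltNge => /negP; apply.
have := bnd (N%:R * t).
suff -> : k (N%:R * t) - N%:R * t * k 1 = N%:R * (k t - t * k 1).
  by rewrite normrM ger0_norm.
by rewrite -mulrA !mulr_natl -[k]/(k' : R -> R) raddfMn -mulrnBl.
Qed.

(** Peel rank-one terms off [B]; by [qiso_translation] each contributes the same increment above
    [A + B] as above [B]. *)
Lemma qiso_additive f g A B : (1 < n)%N -> qiso f g -> A^T = A -> B^T = B ->
  f (A + B) - f 0 = (f A - f 0) + (f B - f 0).
Proof.
move=> n1 h + sB; move: B sB A; apply: sym_ind => [|B t w sB IH] A sA.
  by rewrite addr0 subrr addr0.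
have split3 (a b c : 'M[R]_n) : a - c = (a - b) + (b - c) by rewrite addrA subrK.
rewrite addrA (split3 _ (f (A + B))) (split3 (f (B + _)) (f B)) IH //.
rewrite !(qiso_translation _ _ n1 h) //; [exact: addrCA|exact: symD].
Qed.

(** On a rank-one line, each value of the quadratic form is an additive monotone function of the
    parameter, hence linear. Additivity extends this to sums. *)
Lemma qiso_homogeneous f g s A : (1 < n)%N -> qiso f g -> A^T = A ->
  f (s *: A) - f 0 = s *: (f A - f 0).
Proof.
move=> n1 h; have s0 : (0 : 'M[R]_n)^T = 0 := trmx0 _ _ _.
have hD := qiso_additive n1 h.
move: A; apply: sym_ind => [|A t w sA IH]; first by rewrite scaler0 subrr scaler0.
have out r : f (r *: outer w) - f 0 = r *: (f (outer w) - f 0).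
  have sw q : (q *: outer w)^T = q *: outer w by exact/symZ/sym_outer.
  have sh B : B^T = B -> (f B - f 0)^T = f B - f 0.
    by move=> sB; apply: symB; exact: (qiso_sym h).
  apply: bform_inj => [||v]; [exact: sh|by apply/symZ/sh/sym_outer|].
  pose k q := bform (f (q *: outer w) - f 0) v v.
  rewrite bformZ -{2}[outer w]scale1r.
  apply: (@additive_monotone_linear k) => [p q|q q0].
    by rewrite /k scalerDl hD // bformD.
  rewrite /k bformB subr_ge0; apply: (qiso_homo h) => //.
  by rewrite -(scale0r (outer w)); exact: qle_outer.
have sw : (outer w)^T = outer w := sym_outer w.
rewrite scalerDr scalerA (hD _ _ (symZ s sA) (symZ (s * t) sw)) IH out.
by rewrite (hD _ _ sA (symZ t sw)) out [in RHS]scalerDr scalerA.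
Qed.

End OrderIso.

(** * Linear maps preserving rank-one squares are congruences *)

Section RankOnePreserver.

Context {R : realType} {n : nat}.
Implicit Types (A B M : 'M[R]_n) (a b e u v w x y z : 'cV[R]_n).

Lemma linear_term_eq0 (m l : R) :
  0 <= l -> (forall t, 0 <= t * m + t ^+ 2 * l) -> m = 0.
Proof.
move=> l0 H; have l1 : l + 1 != 0 by rewrite gt_eqF // ltr_wpDl.
(* The shift by 1 keeps the denominator nonzero when [l = 0]. *)
have := H (- m / (l + 1)).
have -> : - m / (l + 1) * m + (- m / (l + 1)) ^+ 2 * l = - (m / (l + 1)) ^+ 2.
  by field.
rewrite oppr_ge0 => m0; have /eqP : (m / (l + 1)) ^+ 2 = 0.
  by apply/eqP; rewrite eq_le m0 sqr_ge0.
by rewrite sqrf_eq0 mulf_eq0 invr_eq0 (negbTE l1) orbF => /eqP.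
Qed.

Lemma dual_vector a b : ~ (exists k, a = k *: b) ->
  exists u, dot a u = 1 /\ dot b u = 0.
Proof.
move=> ab; apply: contrapT => H; apply: ab; apply: colinear_of_orth => v bv.
apply/eqP; apply: contraT => av; case: H; exists ((dot a v)^-1 *: v).
by rewrite !dotZr bv mulr0 mulVf.
Qed.

(** On vectors [u], [w] dual to [a], [b], positivity for all [t] kills the diagonal values of [M].
    Rank one at [t = 1] makes [bform M u w] a sign and puts the vectors orthogonal to [a] and [b] in
    the kernel. *)
Lemma rank1_pencil a b M : M^T = M ->
  ~ (exists k, a = k *: b) -> ~ (exists k, b = k *: a) ->
  (forall t, exists c, outer a + t *: M + t ^+ 2 *: outer b = outer c) ->
  exists2 s, s ^+ 2 = 1 & M = s *: (a *m b^T + b *m a^T).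
Proof.
move=> sM /dual_vector [u [au bu]] /dual_vector [w [bw aw]] H.
have pos t v : 0 <= dot a v ^+ 2 + t * bform M v v + t ^+ 2 * dot b v ^+ 2.
  have [c /(congr1 (fun A => bform A v v))] := H t.
  by rewrite !bformE -!expr2 => ->; exact: sqr_ge0.
(* Vanishing of the 2 by 2 minors of the rank-one form at [t = 1]. *)
have rk p q : (dot a p * dot a q + bform M p q + dot b p * dot b q) ^+ 2 =
    (dot a p ^+ 2 + bform M p p + dot b p ^+ 2) *
    (dot a q ^+ 2 + bform M q q + dot b q ^+ 2).
  have [c] := H 1; rewrite expr1n !scale1r => E.
  have F r s : dot a r * dot a s + bform M r s + dot b r * dot b s =
      dot c r * dot c s by rewrite -!bform_outer -!bformD E.
  by rewrite !expr2 !F; ring.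
have Ma v : dot a v = 0 -> bform M v v = 0.
  move=> av; apply: (@linear_term_eq0 _ (dot b v ^+ 2)) (sqr_ge0 _) _ => t.
  by have := pos t v; rewrite av expr0n /= add0r.
have Mu : bform M u u = 0.
  apply: (@affine_ge0_slope0 _ _ (dot a u ^+ 2)) => t.
  by have := pos t u; rewrite bu expr0n /= mulr0 addr0.
have Mw := Ma _ aw.
exists (bform M u w).
  by have := rk u w; rewrite au aw bu bw Mu Mw; lra.
apply: bform_inj => // [|v].
  by apply: symZ; rewrite linearD /= !trmx_mul !trmxK addrC.
have [z [vE az bz]] : exists z, [/\ v = z + (dot a v *: u + dot b v *: w),
    dot a z = 0 & dot b z = 0].
  exists (v - (dot a v *: u + dot b v *: w)); rewrite subrK -scaleN1r.
  by rewrite !dotDr !dotZr !dotDr !dotZr au aw bu bw; split=> //; ring.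
have Mz := Ma _ az.
have z0 p : bform M p z = 0.
  have := rk p z; rewrite az bz Mz !mulr0 add0r addr0 expr0n /= !addr0 mulr0.
  by move=> /eqP; rewrite sqrf_eq0 => /eqP.
have -> : bform M v v = 2 * dot a v * dot b v * bform M u w.
  rewrite {1 2}vE.
  move: (dot a v) (dot b v) z0 => p q z0; rewrite !bformE !(bformC z _ sM) !z0.
  by rewrite Mu Mw (bformC w u sM); ring.
by rewrite bformZ bformD !bform_mul; ring.
Qed.

(** The image of [outer x] fixes a vector only up to sign; the cross terms with a fixed [e] choose
    the signs linearly in [x]. *)
Lemma rank1_preserver (h : 'M[R]_n -> 'M[R]_n) : (0 < n)%N ->
  (forall A, A^T = A -> (h A)^T = h A) ->
  (forall A B, A^T = A -> B^T = B -> h (A + B) = h A + h B) ->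
  (forall s A, A^T = A -> h (s *: A) = s *: h A) ->
  (forall A, A^T = A -> h A = 0 -> A = 0) ->
  (forall x, exists y, h (outer x) = outer y) ->
  exists2 T, T \in unitmx & forall A, A^T = A -> h A = T *m A *m T^T.
Proof.
move=> n0 hS hD hZ hI hO.
have [e e0] : exists e, e != 0.
  exists (const_mx 1); apply/eqP => /colP /(_ (Ordinal n0)) /eqP.
  by rewrite !mxE oner_eq0.
have [a ha] := hO e.
have a0 : a != 0.
  apply: contra_neq e0 => a0; apply/outer_eq0/hI; first exact: sym_outer.
  by rewrite ha a0 /outer mul0mx.
have [u au] : exists u, dot a u = 1.
  by exists ((dot a a)^-1 *: a); rewrite dotZr mulVf // gt_eqF // dot_gt0.
pose S x := e *m x^T + x *m e^T.
have sS x : (S x)^T = S x by rewrite linearD /= !trmx_mul !trmxK addrC.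
(* If $h(S x) = s(ab^T + ba^T)$ and $a \cdot u = 1$, the first term is $s b + s (b \cdot u) a$ and
   the second removes the multiple of $a$, leaving $s b$. *)
pose t x := h (S x) *m u - (bform (h (S x)) u u / 2) *: a.
have hSl : linear (h \o S).
  move=> s x y /=; rewrite -hZ // -hD //; last exact: symZ.
  by rewrite /S linearP /= mulmxDr mulmxDl -scalemxAr -scalemxAl scalerDr addrACA.
have tl : linear t.
  move=> s x y; have /= E := hSl s x y; rewrite /t E mulmxDl -scalemxAl !bformE.
  rewrite scalerBr !scalerA addrACA; congr (_ + _).
  by rewrite -opprD -scalerDl mulrDl mulrA.
pose tL : {linear 'cV[R]_n -> 'cV[R]_n} :=
  HB.pack t (GRing.isLinear.Build R _ _ _ t tl).
(* [lin1_mx] acts on row vectors, hence the transposes. *)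
pose T := (lin1_mx (trmx \o tL \o trmx))^T.
have TE x : T *m x = t x.
  by rewrite -[T *m x]trmxK trmx_mul trmxK mul_rV_lin1 /= !trmxK.
have expand x r : outer (e + r *: x) = outer e + r *: S x + r ^+ 2 *: outer x.
  rewrite outer_polar outerZ /S linearZ /= -scalemxAr -scalemxAl -scalerDr.
  by rewrite addrAC.
have tO x : h (outer x) = outer (t x).
  have [b hb] := hO x.
  (* For [x] along [e] the images are colinear and the pencil argument does not apply, so [t x] is
     computed directly. *)
  have [[k xk]|xe] := pselect (exists k, x = k *: e).
    have hSx : h (S x) = (2 * k) *: outer a.
      rewrite -ha -hZ ?sym_outer //; congr h.
      rewrite /S xk linearZ /= -scalemxAr -scalemxAl -/(outer e).
      by rewrite -scalerDl mulr_natl mulr2n.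
    have -> : t x = k *: a.
      rewrite /t hSx bformZ bform_outer au !mulr1 -scalemxAl.
      rewrite /outer -mulmxA [a^T *m u]mx11_scalar -[(a^T *m u) 0 0]/(dot a u) au.
      by rewrite mulmx1 -scalerBl; congr (_ *: _); field.
    by rewrite xk !outerZ hZ ?sym_outer // ha.
  (* Colinear images would put [outer x - k ^+ 2 *: outer e] in the kernel of [h]. *)
  have ba : ~ exists k, b = k *: a.
    move=> [k bk]; apply: xe.
    apply: (@colinear_of_outer _ _ (k ^+ 2)); apply/eqP.
    have sx := sym_outer x; have se r : (r *: outer e)^T = r *: outer e.
      exact/symZ/sym_outer.
    rewrite -subr_eq0 -scaleNr; apply/eqP/hI; first exact: symD.
    by rewrite hD // hZ ?sym_outer // hb ha bk outerZ scaleNr subrr.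
  have ab : ~ exists k, a = k *: b.
    move=> [k ak]; apply: ba; exists k^-1; rewrite ak scalerA mulVf ?scale1r //.
    by apply: contra_neq a0 => k0; rewrite ak k0 scale0r.
  have [r|s s1 hSx] := @rank1_pencil a b (h (S x)) (hS _ (sS x)) ab ba.
    have [c hc] := hO (e + r *: x); exists c; rewrite -hc expand.
    have sr := symZ r (sS x); have se := sym_outer e.
    rewrite (hD _ _ (symD se sr) (symZ _ (sym_outer x))) (hD _ _ se sr).
    by rewrite !hZ ?sym_outer ?sS // ha hb.
  rewrite hb; apply: bform_inj => [||v]; try exact: sym_outer.
  rewrite !bform_outer /t -scaleNr dotDl dotZl dotC.
  rewrite [dot (h (S x) *m u) v]dotC -/(bform _ v u) hSx !bformZ !bformD !bform_mul au.
  rewrite (dotC v b); transitivity (s ^+ 2 * (dot b v * dot b v)); last by field.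
  by rewrite s1 mul1r.
have TI x : T *m x = 0 -> x = 0.
  move=> Tx; apply/outer_eq0/hI; first exact: sym_outer.
  by rewrite tO -TE Tx /outer mul0mx.
exists T.
  rewrite -unitmx_tr -row_free_unit; apply: inj_row_free => v vT.
  by rewrite -[v]trmxK (TI v^T) ?trmx0 // -[T]trmxK -trmx_mul vT trmx0.
apply: sym_ind => [|A s w sA IH].
  have := hZ 0 0 (trmx0 _ _ _); rewrite !scale0r => ->.
  by rewrite mulmx0 mul0mx.
rewrite hD ?hZ ?sym_outer ?IH ?tO //; last exact/symZ/sym_outer.
rewrite mulmxDr mulmxDl -scalemxAr -scalemxAl -TE.
by rewrite /outer trmx_mul !mulmxA.
Qed.

End RankOnePreserver.

(** * Passage between the subtype of symmetric matrices and bare matrices *)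

Section Loewner.

Context {R : realType} {n : nat}.

Lemma symmetricmxP (A : 'M[R]_n) : reflect (A^T = A) (A \is symmetricmx).
Proof. by rewrite symmetricmxE; exact: eqP. Qed.

Lemma sym_val (X : symmx R n) : (val X)^T = val X.
Proof. exact/symmetricmxP/(valP X). Qed.

Lemma loewner_leE (X Y : symmx R n) : loewner_le X Y <-> qle (val X) (val Y).
Proof.
split=> [[_ XY] v|XY].
  by have := XY v; rewrite -mulmxA -/(dot v _) -/(bform _ v v) bformB subr_ge0.
split=> [|v]; first by apply/symmetricmxP/symB; exact: sym_val.
by rewrite -mulmxA -/(dot v _) -/(bform _ v v) bformB subr_ge0.
Qed.

Lemma order_automorphism_qiso (phi : symmx R n -> symmx R n) :
  order_automorphism phi ->
  exists f g, qiso f g /\ forall X, val (phi X) = f (val X).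
Proof.
move=> [[psi phiK psiK] phile].
have s0 : (0 : 'M[R]_n) \is symmetricmx by apply/symmetricmxP; exact: trmx0.
pose Z : symmx R n := exist _ 0 s0.
(* Extends [phi] and its inverse to all matrices by reading a non-symmetric argument as zero. *)
pose sm (A : 'M[R]_n) : symmx R n := insubd Z A.
have smK A : A^T = A -> val (sm A) = A.
  by move=> /symmetricmxP sA; rewrite /sm insubdK.
have valKs X : sm (val X) = X by rewrite /sm valKd.
exists (fun A => val (phi (sm A))), (fun A => val (psi (sm A))).
split=> [|X]; last by rewrite valKs.
split=> [A _|A _|A sA|A sA|A B sA sB].
- exact: sym_val.
- exact: sym_val.
- by rewrite valKs phiK smK.
- by rewrite valKs psiK smK.
rewrite -{1}(smK _ sA) -{1}(smK _ sB).
exact: iff_trans (iff_sym (loewner_leE _ _))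
  (iff_trans (phile _ _) (loewner_leE _ _)).
Qed.

End Loewner.

Theorem theorem5p4 (R : realType) (n : nat) (hn : (2 <= n)%N)
    (phi : symmx R n -> symmx R n) (hphi : order_automorphism phi) :
  exists (T : 'M[R]_n) (S : symmx R n),
    T \in unitmx /\
    forall X : symmx R n, val (phi X) = T *m val X *m T^T + val S.
Proof.
have [f [g [h phiE]]] := order_automorphism_qiso hphi.
have s0 : (0 : 'M[R]_n)^T = 0 := trmx0 _ _ _.
(* Subtracting [f 0] gives the linear part; [f 0] itself becomes the translation term. *)
have [||||||T uT hT] :=
  @rank1_preserver R n (fun A => f A - f 0).
- exact: ltnW.
- by move=> A sA; apply: symB; exact: (qiso_sym h).
- by move=> A B; exact: (qiso_additive hn h).
- by move=> s A; exact: (qiso_homogeneous s hn h).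
- by move=> A sA /subr0_eq; exact: (qiso_inj h).
- move=> x; have [y fy] := qiso_outer x h s0; exists y.
  by move: fy; rewrite add0r => ->; rewrite addrAC subrr add0r.
have f0 : f 0 \is symmetricmx by apply/symmetricmxP/(qiso_sym h).
exists T, (exist _ (f 0) f0); split=> // X.
by rewrite phiE /= -hT ?subrK //; exact: sym_val.
Qed.
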